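(* Let $\phi:B_E\to B_E$ be analytic and assume that the composition operator $C_\phi:\mathcal B(B_E)\to\mathcal B(B_E)$, $C_\phi f=f\circ\phi$, is compact. Then (1) $\phi(\delta B_E)$ is relatively compact in $E$ for each $0<\delta<1$; (2) $\displaystyle\lim_{\|\phi(z)\|\to 1}\frac{(1- \|z\|^2) \|\mathcal R \phi(z)\|}{\sqrt{1- \|\phi(z)\|^2}}=0$; and (3) $\displaystyle\lim_{\|\phi(z)\|\to 1}\frac{(1- \|z\|^2) |\langle \phi(z), \mathcal R\phi(z)\rangle|}{1- \|\phi(z)\|^2}=0$.
   Context: $E$ is a complex Hilbert space of arbitrary dimension with inner product $\langle\cdot,\cdot\rangle$ and open unit ball $B_E$. For an analytic map $\phi:B_E\to E$, $\mathcal R\phi(x)=\phi'(x)(x)$ is its radial derivative. A limit $\lim_{\|\phi(z)\|\to 1} Q(z)=0$ means: for every $\varepsilon>0$ there is $r<1$ such that $|Q(z)|<\varepsilon$ whenever $\|\phi(z)\|>r$. The Bloch space $\mathcal B(B_E)$ is the space of analytic $f:B_E\to\mathbb C$ with $\|f\|_{\mathcal B(B_E)}=\sup_{x\in B_E}(1-\|x\|^2)\|f'(x)\|<\infty$, a Banach space under the norm $\|f\|_{Bloch(B_E)}=|f(0)|+\|f\|_{inv}$, where $\|f\|_{inv}=\sup_{x\in B_E}\|\nabla(f\circ\varphi_x)(0)\|$ (an equivalent seminorm), $\nabla g(x)$ being the gradient vector representing $g'(x)$ and $\varphi_x$ the Möbius automorphism of $B_E$ exchanging $0$ and $x$: $\varphi_a(y)=(s_aQ_a+P_a)\big(\frac{a-y}{1-\langle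 y,a\rangle}\big)$, $s_a=\sqrt{1-\|a\|^2}$, $P_a$ the orthogonal projection onto $\mathbb Ca$, $Q_a=I-P_a$. *)

(* Defs.v *)
From HB Require Import structures.
From mathcomp Require Import all_boot all_order all_algebra.
From mathcomp Require Import all_classical all_reals all_analysis.
From mathcomp Require Import complex.
Import Order.TTheory GRing.Theory Num.Theory.
Import numFieldNormedType.Exports.

Set Implicit Arguments.
Unset Strict Implicit.
Unset Printing Implicit Defensive.

Local Open Scope ring_scope.
Local Open Scope classical_set_scope.

Section Defs.
Variable R : realType.
Local Notation C := (R[i]).

(* real-valued norm (the norm of a normed C-module is a real element of C) *)
Definition nrm (V : normedZmodType C) (x : V) : R := complex.Re `|x|.

Section Space.
Variable E : normedModType C.

Definition is_inner_product (ip : E -> E -> C) : Prop :=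
  [/\ forall (a : C) (x1 x2 y : E), ip (a *: x1 + x2) y = a * ip x1 y + ip x2 y,
      forall x y : E, ip y x = (ip x y)^*
    & forall x : E, ip x x = (`|x| : C) ^+ 2].

Definition unit_ball : set E := [set x | nrm x < 1].

(* analytic (= Frechet C-differentiable, i.e. holomorphic) on an open set *)
Definition analytic_on (W : normedModType C) (A : set E) (f : E -> W) : Prop :=
  forall x, A x -> differentiable f x.

Definition radial_der (phi : E -> E) (x : E) : E := 'd phi x x.

Variable ip : E -> E -> C.

Definition projP (a : E) (v : E) : E :=
  if a == 0 then 0 else (ip v a / ip a a) *: a.

(* Moebius automorphism phi_a(y) = (s_a Q_a + P_a)((a - y)/(1 - <y,a>)) *)
Definition mobius (a : E) (y : E) : E :=
  let w := (1 - ip y a)^-1 *: (a - y) in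
  (Complex (Num.sqrt (1 - nrm a ^+ 2)) 0) *: (w - projP a w) + projP a w.

(* operator norm of a linear functional (= norm of its gradient vector) *)
Definition opnorm (L : E -> C^o) : \bar R :=
  ereal_sup [set (nrm (L v))%:E | v in [set v : E | nrm v <= 1]].

Definition bloch (f : E -> C^o) : Prop :=
  analytic_on unit_ball f /\
  exists M : R, forall x, unit_ball x ->
    forall v : E, nrm v <= 1 -> (1 - nrm x ^+ 2) * nrm ('d f x v) <= M.

Definition inv_seminorm (f : E -> C^o) : \bar R :=
  ereal_sup [set opnorm ('d (f \o mobius a) 0) | a in unit_ball].

Definition bloch_norm (f : E -> C^o) : \bar R :=
  ((nrm (f 0))%:E + inv_seminorm f)%E.

(* C_phi : B(B_E) -> B(B_E), f |-> f o phi, is a (well-defined) compact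
   operator: it maps the Bloch space into itself and the image of the closed
   unit ball is relatively compact, i.e. every sequence in the unit ball has a
   subsequence whose image converges in the Bloch norm to an element of the
   Bloch space. *)
Definition compact_comp_op (phi : E -> E) : Prop :=
  (forall f, bloch f -> bloch (f \o phi)) /\
  forall u : nat -> (E -> C^o),
    (forall n, bloch (u n) /\ (bloch_norm (u n) <= 1)%E) ->
    exists (sigma : nat -> nat) (g : E -> C^o),
      {homo sigma : m n / (m < n)%N >-> (m < n)%N} /\ bloch g /\
      (fun k => bloch_norm ((u (sigma k)) \o phi - g)) @ \oo --> 0%E.

End Space.
End Defs.

(* Main.v *)
(* If |u_n| <= 1 in the Bloch norm and u_n -> 0 pointwise, then compactness of
   C_phi makes a subsequence of u_n o phi tend to 0 in the Bloch norm, hence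
   (1 - |z|^2) |(u_n o phi)'(z)(z)| -> 0 uniformly in z along it.  For (2) and (3)
   this is applied with a = phi(z_n), |a| -> 1, to the normalised functions
     x |-> sqrt(1 - |a|^2) (alpha + <x, e>) / (1 - <x, a>),
   where |e| <= 1, e is orthogonal to a and 0 <= alpha <= sqrt(1 - |a|^2): their
   derivatives at a along R phi(z_n) recover the component of R phi(z_n) along a
   (e = 0) and the one orthogonal to a (alpha = 0).  Their Bloch norms are bounded
   because 1 - |a|^2, 1 - |b|^2, |<b, e>|^2 and 1 - |<b, a>|^2 are all at most
   2 |1 - <b, a>|, and the derivative D_b of phi_b at 0 is self-adjoint with
   |D_b v|^2 = (1 - |b|^2) (|v|^2 - |<v, b>|^2).
   For (1), the functions f o phi with |f| <= 1 are totally bounded uniformly on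
   delta B, and the functionals <., e> among the f recover the norm of E. *)
Require Import Defs.
From HB Require Import structures.
From mathcomp Require Import all_boot all_order all_algebra.
From mathcomp Require Import all_classical all_reals all_analysis.
From mathcomp Require Import complex ring lra.
Import Order.TTheory GRing.Theory Num.Theory.
Import numFieldNormedType.Exports.
Local Open Scope ring_scope.
Local Open Scope classical_set_scope.
Set Implicit Arguments.
Unset Strict Implicit.
Unset Printing Implicit Defensive.

(** * Complex norms and inner products *)

Section ComplexNorm.
Context {R : realType}.
Local Notation C := R[i].
Local Notation rC := (real_complex R).

Section NormedZmodule.
Variable V : normedZmodType C.
Implicit Types x y : V.

Lemma nrmE x : `|x| = rC (nrm x).
Proof. by rewrite /nrm RRe_real // normr_real. Qed.

Lemma nrm_ge0 x : 0 <= nrm x.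
Proof. by rewrite -ler0c -nrmE. Qed.

Lemma nrm0 : nrm (0 : V) = 0.
Proof. by rewrite /nrm normr0. Qed.

Lemma nrm_eq0 x : (nrm x == 0) = (x == 0).
Proof. by rewrite -[RHS]normr_eq0 nrmE (inj_eq (@complexI R) _ 0). Qed.

Lemma nrmN x : nrm (- x) = nrm x.
Proof. by rewrite /nrm normrN. Qed.

Lemma nrm_distC x y : nrm (x - y) = nrm (y - x).
Proof. by rewrite -nrmN opprB. Qed.

Lemma nrmD x y : nrm (x + y) <= nrm x + nrm y.
Proof. by rewrite -lecR rmorphD /= -!nrmE ler_normD. Qed.

Lemma nrmB x y : nrm (x - y) <= nrm x + nrm y.
Proof. by rewrite -(nrmN y) nrmD. Qed.

End NormedZmodule.

Lemma nrmM (a b : C) : nrm (a * b) = nrm a * nrm b.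
Proof. by apply: complexI; rewrite rmorphM /= -!nrmE normrM. Qed.

Lemma nrmV (a : C) : nrm a^-1 = (nrm a)^-1.
Proof. by apply: complexI; rewrite fmorphV /= -!nrmE normfV. Qed.

Lemma nrmZ (V : normedModType C) (a : C) (x : V) : nrm (a *: x) = nrm a * nrm x.
Proof. by apply: complexI; rewrite rmorphM /= -!nrmE normrZ. Qed.

Lemma nrm_real (r : R) : nrm (rC r) = `|r|.
Proof. by rewrite /nrm normc_def /= expr0n /= addr0 sqrtr_sqr. Qed.

Lemma nrm1 : nrm (1 : C) = 1.
Proof. by rewrite /nrm normr1. Qed.

Lemma nrm_conj (a : C) : nrm a^* = nrm a.
Proof. by rewrite /nrm norm_conjC. Qed.

Lemma mul_conj_nrm (a : C) : a * a^* = rC (nrm a ^+ 2).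
Proof. by rewrite rmorphXn /= -nrmE normCK. Qed.

Lemma ler_Re_nrm (a : C) : `|complex.Re a| <= nrm a.
Proof.
rewrite /nrm normc_def /= -sqrtr_sqr ler_wsqrtr // lerDl; exact: sqr_ge0.
Qed.

Lemma ler_Im_nrm (a : C) : `|complex.Im a| <= nrm a.
Proof.
rewrite /nrm normc_def /= -sqrtr_sqr ler_wsqrtr // lerDr; exact: sqr_ge0.
Qed.

Lemma ler_nrm_ReIm (a : C) : nrm a <= `|complex.Re a| + `|complex.Im a|.
Proof.
rewrite /nrm normc_def /= -[leRHS]ger0_norm ?addr_ge0// -sqrtr_sqr ler_wsqrtr//.
by rewrite sqrrD !real_normK ?num_real// lerD2r lerDl mulrn_wge0// mulr_ge0.
Qed.

End ComplexNorm.

Section InnerProduct.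
Context {R : realType}.
Local Notation C := R[i].
Local Notation rC := (real_complex R).
Variable E : normedModType C.
Variable ip : E -> E -> C.
Hypothesis ip_inner : is_inner_product ip.
Implicit Types (x y v b : E) (a : C).

Lemma ipDl x1 x2 y : ip (x1 + x2) y = ip x1 y + ip x2 y.
Proof. by case: ip_inner => h _ _; have := h 1 x1 x2 y; rewrite scale1r mul1r. Qed.

Lemma ip0l y : ip 0 y = 0.
Proof. by apply: (@addrI _ (ip 0 y)); rewrite -ipDl !addr0. Qed.

Lemma ipZl a x y : ip (a *: x) y = a * ip x y.
Proof. by case: ip_inner => h _ _; have := h a x 0 y; rewrite ip0l !addr0. Qed.

Lemma ipC x y : ip y x = (ip x y)^*.
Proof. by case: ip_inner. Qed.

Lemma ipDr x y1 y2 : ip x (y1 + y2) = ip x y1 + ip x y2.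
Proof. by rewrite ipC ipDl rmorphD /= -!ipC. Qed.

Lemma ipZr a x y : ip x (a *: y) = a^* * ip x y.
Proof. by rewrite ipC ipZl rmorphM /= -ipC. Qed.

Lemma ip0r x : ip x 0 = 0.
Proof. by rewrite ipC ip0l rmorph0. Qed.

Lemma ipNl x y : ip (- x) y = - ip x y.
Proof. by rewrite -scaleN1r ipZl mulN1r. Qed.

Lemma ipBl x1 x2 y : ip (x1 - x2) y = ip x1 y - ip x2 y.
Proof. by rewrite ipDl ipNl. Qed.

Lemma ipNr x y : ip x (- y) = - ip x y.
Proof. by rewrite ipC ipNl rmorphN /= -ipC. Qed.

Lemma ipBr x y1 y2 : ip x (y1 - y2) = ip x y1 - ip x y2.
Proof. by rewrite ipDr ipNr. Qed.

Lemma ipxx x : ip x x = rC (nrm x ^+ 2).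
Proof. by case: ip_inner => _ _ ->; rewrite nrmE rmorphXn. Qed.

Lemma nrm_ipC x y : nrm (ip x y) = nrm (ip y x).
Proof. by rewrite ipC nrm_conj. Qed.

Lemma ip_mulC x y : ip x y * ip y x = rC (nrm (ip x y) ^+ 2).
Proof. by rewrite [ip y x]ipC mul_conj_nrm. Qed.

(** Cauchy-Schwarz, from expanding the squared norm of |y|^2 x - <x, y> y; this choice of vector
    avoids dividing by |y|^2. *)
Lemma nrm_ip_le x y : nrm (ip x y) <= nrm x * nrm y.
Proof.
have [->|y0] := eqVneq y 0; first by rewrite ip0r !nrm0 mulr0.
have ny : 0 < nrm y by rewrite lt_neqAle nrm_ge0 eq_sym nrm_eq0 y0.
have : nrm (rC (nrm y ^+ 2) *: x - ip x y *: y) ^+ 2 =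
   nrm y ^+ 2 * (nrm x ^+ 2 * nrm y ^+ 2 - nrm (ip x y) ^+ 2).
  apply: complexI; rewrite -(ipxx (_ - _)) !(ipBl, ipBr, ipZl, ipZr) !ipxx.
  have RE (p q r : R) : rC (p * (q * p - r)) = rC p * (rC q * rC p - rC r).
    by rewrite rmorphM rmorphB rmorphM.
  rewrite -!ipC {}RE -ip_mulC.
  have -> : (rC (nrm y ^+ 2))^* = rC (nrm y ^+ 2) by rewrite -!ipxx -ipC.
  ring.
move=> h; have := sqr_ge0 (nrm (rC (nrm y ^+ 2) *: x - ip x y *: y)).
rewrite h pmulr_rge0 ?exprn_gt0// subr_ge0 -exprMn.
by rewrite ler_pXn2r ?nnegrE ?mulr_ge0 ?nrm_ge0.
Qed.

End InnerProduct.

(** * Rules for Frechet differentials *)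

Section Differentials.
Context {R : realType}.
Local Notation C := R[i].
Local Notation rC := (real_complex R).

Lemma is_diff_bounded_linear (V W : normedModType C) (f : V -> W) (M : R) (x : V) :
  linear f -> (forall v, nrm (f v) <= M * nrm v) -> is_diff x f f.
Proof.
move=> f_lin fM.
pose fL : {linear V -> W} := HB.pack f (GRing.isLinear.Build _ _ _ _ _ f_lin).
have fL_cont : continuous fL.
  apply/(linear_bounded_continuous fL).1/bounded_funP => r.
  exists (rC (`|M| * complex.Re r)) => v vr.
  (* A complex number that dominates a norm is real, because the order of [C] only compares numbers
     with equal imaginary parts. *)
  have rE : r = rC (complex.Re r) by rewrite RRe_real// ger0_real// (le_trans _ vr).
  move: vr; rewrite {1}rE !nrmE !lecR => vr; apply: (le_trans (fM v)).
  apply: (@le_trans _ _ (`|M| * nrm (v : V))); last by rewrite ler_wpM2l.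
  by rewrite ler_wpM2r ?nrm_ge0// ler_norm.
rewrite -[f]/(fL : _ -> _).
apply: DiffDef; first exact: linear_differentiable.
by rewrite diff_lin.
Qed.

(** Chain rule through the continuous bilinear map (a, w) |-> a w. The Moebius map is such a product
    of a scalar and a vector function. *)
Lemma is_diff_scale (V W : normedModType C) (k dk : V -> C^o) (f df : V -> W) (x : V) :
  is_diff x k dk -> is_diff x f df ->
  is_diff x (fun y => k y *: f y) (fun h => k x *: df h + dk h *: f x).
Proof.
move=> dkx dfx.
have scale_bilin : bilinear_for
    (GRing.Scale.Law.clone _ _ *:%R _) (GRing.Scale.Law.clone _ _ *:%R _)
    (fun (a : C^o) (w : W) => a *: w).
  by split=> [w|a] c y z /=; rewrite ?scalerDl ?scalerDr ?scalerA // mulrC.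
pose s : {bilinear C^o -> W -> W} :=
  HB.pack (fun (a : C^o) (w : W) => a *: w) (bilinear_isBilinear.Build C C^o W W _ _ _ scale_bilin).
have s_cont : continuous (fun p : C^o * W => s p.1 p.2) by exact: scale_continuous.
have ds : is_diff (k x, f x) (fun p : C^o * W => s p.1 p.2)
    (fun p => s (k x) p.2 + s p.1 (f x)).
  by apply: DiffDef; [exact: differentiable_bilin | rewrite diff_bilin].
exact: (is_diff_comp (is_diff_pair dkx dfx) ds).
Qed.

Lemma is_diff_inv (V : normedModType C) (k dk : V -> C^o) (x : V) :
  is_diff x k dk -> k x != 0 ->
  is_diff x (fun y => (k y)^-1 : C^o) (fun h => - (k x) ^- 2 * dk h : C^o).
Proof.
move=> dkx kx0; apply: DiffDef; first exact: (@differentiableV C V k).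
by rewrite (@diffV C V k) // diff_val.
Qed.

End Differentials.

(** * Moebius maps *)

Section Moebius.
Context {R : realType}.
Local Notation C := R[i].
Local Notation rC := (real_complex R).
Variable E : normedModType C.
Variable ip : E -> E -> C.
Hypothesis ip_inner : is_inner_product ip.
Implicit Types (x y v w b e : E).

Let ipDl := ipDl ip_inner.
Let ipZl := ipZl ip_inner.
Let ipBl := ipBl ip_inner.
Let ipDr := ipDr ip_inner.
Let ipZr := ipZr ip_inner.
Let ipBr := ipBr ip_inner.
Let ipC := ipC ip_inner.
Let ipxx := ipxx ip_inner.

Definition mobius_s b : R := Num.sqrt (1 - nrm b ^+ 2).

(* [s_b Q_b + P_b], written without the division by [ip b b] of [projP] so that
   [b = 0] is not a special case: [(1 - s_b) / |b|^2 = 1 / (1 + s_b)]. *)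
Definition mobius_lin b v : E :=
  rC (mobius_s b) *: v + (ip v b / rC (1 + mobius_s b)) *: b.

(* The differential of [mobius ip b] at [0]. *)
Definition mobius_diff0 b v : E :=
  rC (mobius_s b) *: ((ip v b / rC (1 + mobius_s b)) *: b - v).

Lemma mobius_s_ge0 b : 0 <= mobius_s b. Proof. exact: sqrtr_ge0. Qed.

Lemma sqr_mobius_s b : unit_ball b -> mobius_s b ^+ 2 = 1 - nrm b ^+ 2.
Proof.
move=> b1; rewrite sqr_sqrtr // subr_ge0 expr_le1 ?nrm_ge0 //; exact: ltW.
Qed.

Lemma mobius_s_gt0 b : unit_ball b -> 0 < mobius_s b.
Proof.
by move=> b1; rewrite sqrtr_gt0 subr_gt0 expr_lt1 ?nrm_ge0.
Qed.

Lemma mobius_s_le1 b : mobius_s b <= 1.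
Proof. by rewrite -sqrtr1 ler_wsqrtr// lerBlDr lerDl sqr_ge0. Qed.

Let s1_neq0 b : rC (1 + mobius_s b) != 0.
Proof.
rewrite (inj_eq (@complexI R) _ 0) gt_eqF // ltr_pwDl ?mobius_s_ge0 //.
Qed.

(** With |b|^2 written as 1 - s_b^2, the identities below become rational in s_b and [field] settles
    them. *)
Let ipbb b : unit_ball b -> ip b b = 1 - rC (mobius_s b) ^+ 2.
Proof.
move=> b1; rewrite ipxx -rmorphXn sqr_mobius_s // rmorphB rmorph1 /=.
by rewrite opprB addrC subrK.
Qed.

Lemma conj_rC (r : R) : (rC r)^* = rC r.
Proof. exact: conjc_real. Qed.

Lemma mobius_linE b v : unit_ball b ->
  mobius_lin b v = rC (mobius_s b) *: (v - projP ip b v) + projP ip b v.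
Proof.
move=> b1; rewrite /projP /mobius_lin.
case: eqVneq => [->|b0]; first by rewrite !scaler0 subr0.
have bb0 : ip b b != 0.
  by rewrite ipxx (inj_eq (@complexI R) _ 0) sqrf_eq0 nrm_eq0.
rewrite scalerBr -addrA; congr (_ + _).
rewrite scalerA -scaleNr -scalerDl; congr (_ *: _).
move: bb0; rewrite (ipbb b1) => bb0.
have := s1_neq0 b; rewrite rmorphD rmorph1 /= => s10.
field; rewrite s10 /= bb0 //.
Qed.

Lemma mobius_lin_linear b : linear (mobius_lin b).
Proof.
move=> a x y; rewrite /mobius_lin ipDl ipZl !scalerDr !scalerA mulrDl scalerDl.
by rewrite [a * rC _]mulrC mulrA addrACA.
Qed.

Lemma mobius_linZ b a v : mobius_lin b (a *: v) = a *: mobius_lin b v.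
Proof.
by rewrite /mobius_lin ipZl scalerDr !scalerA mulrA [a * rC _]mulrC.
Qed.

Lemma mobiusE b y : unit_ball b ->
  mobius ip b y = (1 - ip y b)^-1 *: mobius_lin b (b - y).
Proof. by move=> b1; rewrite -mobius_linZ mobius_linE. Qed.

Lemma mobius_lin_self b : unit_ball b -> mobius_lin b b = b.
Proof.
move=> b1; rewrite /mobius_lin -scalerDl (ipbb b1).
rewrite -[RHS]scale1r; congr (_ *: _).
have := s1_neq0 b; rewrite rmorphD rmorph1 /= => s10.
by field.
Qed.

(** The form delivered by the product rule at 0: the first term comes from the scalar factor 1 / (1
    - <y, b>), the second from the linear one. *)
Lemma mobius_diff0E b v : mobius_diff0 b v = ip v b *: b - mobius_lin b v.
Proof.
rewrite /mobius_diff0 /mobius_lin scalerBr scalerA opprD.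
rewrite [- _ - _ in RHS]addrC addrA; congr (_ - _).
rewrite -scalerBl; congr (_ *: _).
have := s1_neq0 b; rewrite rmorphD rmorph1 /= => s10.
by field.
Qed.

(** D_b is a real combination of the identity and of v |-> <v, b> b. *)
Lemma mobius_diff0_adj b v w : ip (mobius_diff0 b v) w = ip v (mobius_diff0 b w).
Proof.
rewrite /mobius_diff0 !(ipZl, ipZr, ipBl, ipBr) !conj_rC.
by rewrite rmorphM /= -ipC -fmorphV conj_rC; ring.
Qed.

Lemma nrm_mobius_diff0 b v : unit_ball b ->
  nrm (mobius_diff0 b v) ^+ 2 =
    (1 - nrm b ^+ 2) * (nrm v ^+ 2 - nrm (ip v b) ^+ 2).
Proof.
move=> b1; rewrite -sqr_mobius_s //.
have RE (p q r : R) : rC (p ^+ 2 * (q - r)) = rC p ^+ 2 * (rC q - rC r).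
  by rewrite rmorphM rmorphB rmorphXn.
apply: complexI; rewrite {}RE -!ipxx -(ip_mulC ip_inner).
rewrite /mobius_diff0 !(ipZl, ipZr, ipBl, ipBr) (ipbb b1) !rmorphM /= -!fmorphV.
rewrite !conj_rC -ipC !fmorphV.
have := s1_neq0 b; rewrite rmorphD rmorph1 /= => s10.
by field.
Qed.

(** On the line of b the two operators act as -s_b^2 and 1, on its orthogonal complement as -s_b and
    s_b. Inverting D_b in this way lets the invariant seminorm control the derivative itself. *)
Lemma mobius_diff0_lin b v : unit_ball b ->
  mobius_diff0 b (mobius_lin b v) = - rC (mobius_s b ^+ 2) *: v.
Proof.
move=> b1; have h : ip (mobius_lin b v) b = ip v b.
  rewrite /mobius_lin ipDl !ipZl (ipbb b1).
  have := s1_neq0 b; rewrite rmorphD rmorph1 /= => s10.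
  by field.
rewrite /mobius_diff0 h /mobius_lin opprD [- _ - _]addrC addrA subrr add0r.
by rewrite scalerN scalerA -scaleNr -rmorphM expr2.
Qed.

(** The squared norm is s_b^2 |v|^2 + |<v, b>|^2, and Cauchy-Schwarz bounds the last term by (1 -
    s_b^2) |v|^2. *)
Lemma nrm_mobius_lin_le b v : unit_ball b -> nrm (mobius_lin b v) <= nrm v.
Proof.
move=> b1.
have -> : nrm (mobius_lin b v) =
    Num.sqrt (mobius_s b ^+ 2 * nrm v ^+ 2 + nrm (ip v b) ^+ 2).
  rewrite -[LHS]ger0_norm ?nrm_ge0 // -sqrtr_sqr; congr Num.sqrt.
  have RE (p q r : R) : rC (p ^+ 2 * q + r) = rC p ^+ 2 * rC q + rC r.
    by rewrite rmorphD rmorphM rmorphXn.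
  apply: complexI; rewrite {}RE -!ipxx -(ip_mulC ip_inner).
  rewrite /mobius_lin !(ipZl, ipZr, ipDl, ipDr) (ipbb b1) !rmorphM /= -!fmorphV.
  rewrite !conj_rC -ipC !fmorphV.
  have := s1_neq0 b; rewrite rmorphD rmorph1 /= => s10.
  by field.
rewrite -[leRHS]ger0_norm ?nrm_ge0 // -sqrtr_sqr ler_wsqrtr // sqr_mobius_s //.
rewrite mulrBl mul1r -addrA gerDl addrC subr_le0 mulrC -exprMn.
by rewrite ler_sqr ?nnegrE ?mulr_ge0 ?nrm_ge0 // nrm_ip_le.
Qed.

Lemma nrm_mobius_diff0_le b v : unit_ball b ->
  nrm (mobius_diff0 b v) <= mobius_s b * nrm v.
Proof.
move=> b1; rewrite -ler_sqr ?nnegrE ?mulr_ge0 ?nrm_ge0 ?mobius_s_ge0 //.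
rewrite nrm_mobius_diff0 // exprMn sqr_mobius_s //.
by rewrite ler_wpM2l ?gerBl ?sqr_ge0 // -sqr_mobius_s // sqr_ge0.
Qed.

Lemma is_diff_ip e x : is_diff x (ip^~ e : E -> C^o) (ip^~ e : E -> C^o).
Proof.
apply: (@is_diff_bounded_linear R E C^o (ip^~ e) (nrm e) x).
  by move=> a y z; rewrite ipDl ipZl.
by move=> v; rewrite mulrC nrm_ip_le.
Qed.

Lemma mobius0 b : unit_ball b -> mobius ip b 0 = b.
Proof.
move=> b1; rewrite mobiusE // subr0 mobius_lin_self //.
by rewrite (ip0l ip_inner) subr0 invr1 scale1r.
Qed.

Lemma is_diff_mobius0 b : unit_ball b ->
  is_diff (0 : E) (mobius ip b) (mobius_diff0 b).
Proof.
move=> b1.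
have -> : mobius ip b = fun y => ((1 - ip y b)^-1 : C^o) *: mobius_lin b (b - y).
  by apply/funext => y; rewrite mobiusE.
have dk : is_diff (0 : E) (fun y => 1 - ip y b : C^o) (fun y => - ip y b : C^o).
  have d1 := is_diff_cst (1 : C^o) (0 : E).
  apply: (is_diff_eq (is_diffB d1 (is_diff_ip b 0))).
  by rewrite funeqE => y /=; rewrite sub0r.
have k0 : (1 - ip 0 b : C^o) != 0 by rewrite (ip0l ip_inner) subr0 oner_neq0.
have dA : is_diff (0 : E) (fun y => mobius_lin b (b - y)) (fun y => - mobius_lin b y).
  have dL : is_diff (0 : E) (mobius_lin b) (mobius_lin b).
    apply: (@is_diff_bounded_linear R E E (mobius_lin b) 1 0).
      exact: mobius_lin_linear.
    by move=> v; rewrite mul1r nrm_mobius_lin_le.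
  have -> : (fun y => mobius_lin b (b - y)) = cst b - mobius_lin b.
    apply/funext => y /=; rewrite -[in LHS]scaleN1r addrC.
    by rewrite mobius_lin_linear mobius_lin_self // scaleN1r addrC.
  apply: (is_diff_eq (is_diffB (is_diff_cst b _) dL)).
  by rewrite funeqE => y /=; rewrite sub0r.
apply: (is_diff_eq (is_diff_scale (is_diff_inv dk k0) dA)).
rewrite funeqE => h; rewrite mobius_diff0E (ip0l ip_inner) !subr0 invr1.
rewrite expr1n invr1 scale1r mobius_lin_self // addrC.
by rewrite mulN1r opprK.
Qed.

End Moebius.

(** * Bloch functions *)

Section BlochNorm.
Context {R : realType}.
Local Notation C := R[i].
Local Notation rC := (real_complex R).
Variable E : normedModType C.
Implicit Types (x y z v w b e : E) (h : E -> C^o).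

Lemma ReB (a b : C) : complex.Re (a - b) = complex.Re a - complex.Re b.
Proof. by case: a b => [? ?] [? ?]. Qed.

Lemma ReMl (r : R) (a : C) : complex.Re (rC r * a) = r * complex.Re a.
Proof. by case: a => [? ?] /=; rewrite mul0r subr0. Qed.

(** The complex difference quotient of h along z converges, in particular for real increments;
    taking Re after multiplying by c costs at most a factor |c|. *)
Lemma is_derive_real_line h (a z : E) (t : R) :
  differentiable h (rC t *: z) -> forall c : C,
  is_derive t 1 (fun s : R => complex.Re (c * h (rC s *: z)))
    (complex.Re (c * 'd h (rC t *: z) z)).
Proof.
move=> dh c.
have := @diff_derivable _ _ _ h (rC t *: z) z dh.
rewrite /derivable -(deriveE z dh) => /cvg_ex[/= l hl].
have -> : 'D_z h (rC t *: z) = l by apply: cvg_lim hl.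
suff cv : (fun k : R => k^-1 *: (complex.Re (c * h (rC (k *: 1 + t) *: z))
     - complex.Re (c * h (rC t *: z)))) @ 0^' --> complex.Re (c * l).
  by apply: DeriveDef; [apply/cvg_ex; exists (complex.Re (c * l)) | exact: cvg_lim cv].
apply/cvgrPdist_lt => eps eps0.
(* Adding 1 keeps the denominator positive when c = 0. *)
have c1 : 0 < nrm c + 1 by rewrite ltr_wpDl ?nrm_ge0.
have eps1 : 0 < rC (eps / (nrm c + 1)) by rewrite ltcR divr_gt0.
move/cvgrPdist_lt : hl => /(_ _ eps1) [d /= d0 hd].
exists (complex.Re d) => /=; first by move: d0; rewrite ltcE => /andP[].
move=> k /= kd k0.
have {}hd : nrm (l - (rC k)^-1 *: (h (rC k *: z + rC t *: z) - h (rC t *: z)))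
    < eps / (nrm c + 1).
  rewrite -ltcR -nrmE; apply: hd; last by rewrite (inj_eq (@complexI R) _ 0).
  move=> /=; rewrite -normrN opprB subr0 nrmE nrm_real.
  rewrite -[d]RRe_real ?gtr0_real // ltcR.
  by move: kd; rewrite /= sub0r normrN.
have -> : k *: 1 + t = k + t by rewrite scaler1.
have -> : complex.Re (c * l) - k^-1 *: (complex.Re (c * h (rC (k + t) *: z))
     - complex.Re (c * h (rC t *: z))) =
   complex.Re (c * (l - (rC k)^-1 *: (h (rC k *: z + rC t *: z) - h (rC t *: z)))).
  rewrite -ReB -[_ *: _]ReMl -ReB rmorphD scalerDl fmorphV; congr complex.Re.
  by rewrite -mulrBr [RHS]mulrBr; congr (_ - _); exact: mulrCA.
apply: le_lt_trans (ler_Re_nrm _) _; rewrite nrmM.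
move: hd; rewrite ltr_pdivlMr // mulrC; apply: le_lt_trans.
by rewrite ler_wpM2r ?nrm_ge0 // lerDl.
Qed.

(** With c the conjugate of h z - h 0, the real function t |-> Re (c h(t z)) changes by exactly |h z
    - h 0|^2 over [0, 1], so the real mean value theorem applies. *)
Lemma mean_value_line h z (K : R) :
  (forall t : R, 0 <= t <= 1 -> differentiable h (rC t *: z) /\
     nrm ('d h (rC t *: z) z) <= K) ->
  nrm (h z - h 0) <= K.
Proof.
move=> hK.
set c := ((h z - h 0 : C))^*.
pose p (s : R) := complex.Re (c * h (rC s *: z)).
have dp (t : R) : 0 <= t <= 1 -> is_derive t 1 p (complex.Re (c * 'd h (rC t *: z) z)).
  by move=> /hK[dh _]; exact: is_derive_real_line.
have [||t] := @MVT_segment R p (fun t => complex.Re (c * 'd h (rC t *: z) z)) 0 1 ler01.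
- by move=> t; rewrite in_itv /= => /andP[t0 t1]; apply: dp; rewrite !ltW.
- apply: derivable_within_continuous => t; rewrite in_itv /= => t01.
  by have [] := dp t t01.
rewrite in_itv /= => t01.
have -> : p 1 - p 0 = nrm (h z - h 0) ^+ 2.
  rewrite /p -ReB -mulrBr rmorph0 rmorph1 scale0r scale1r.
  by rewrite mulrC mul_conj_nrm.
rewrite subr0 mulr1 => e.
have : nrm (h z - h 0) ^+ 2 <= nrm (h z - h 0) * K.
  rewrite e; apply: (le_trans (ler_norm _)); apply: (le_trans (ler_Re_nrm _)).
  by rewrite nrmM nrm_conj ler_wpM2l ?nrm_ge0 //; have [] := hK _ t01.
(* If h z = h 0 there is nothing to cancel, and K >= 0 follows from the derivative bound. *)
have [->|d0] := eqVneq (nrm (h z - h 0)) 0.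
  by move=> _; apply: le_trans (hK _ t01).2; exact: nrm_ge0.
by rewrite expr2 ler_pM2l // lt_neqAle eq_sym d0 nrm_ge0.
Qed.

End BlochNorm.

Section BlochSpace.
Context {R : realType}.
Local Notation C := R[i].
Local Notation rC := (real_complex R).
Variable E : normedModType C.
Implicit Types (x y z v w b e : E) (h : E -> C^o).

Lemma one_sub_sqr_gt0 x : unit_ball x -> 0 < 1 - nrm x ^+ 2.
Proof. by move=> x1; rewrite subr_gt0 expr_lt1 ?nrm_ge0. Qed.

Lemma unit_ball_near x : unit_ball x -> \forall y \near x, unit_ball y.
Proof.
move=> x1; apply/nbhs_normP; exists (rC (1 - nrm x)).
  by rewrite /= ltcR subr_gt0.
move=> y /=; rewrite nrmE ltcR => xy.
rewrite /unit_ball /= -[y](subrK x) (le_lt_trans (nrmD _ _)) //.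
by rewrite -ltrBrDr nrm_distC.
Qed.

Lemma unit_ball_scale x (t : R) : unit_ball x -> 0 <= t <= 1 -> unit_ball (rC t *: x).
Proof.
move=> x1 /andP[t0 t1]; rewrite /unit_ball /= nrmZ nrm_real ger0_norm //.
by apply: le_lt_trans x1; rewrite ler_piMl ?nrm_ge0.
Qed.

(** The segment from 0 to z stays where |x| <= |z|, so the derivative along it is at most M / (1 -
    |z|^2). This is cruder than logarithmic growth but bounds h on every smaller ball. *)
Lemma bloch_growth h (M : R) z : analytic_on (@unit_ball R E) h ->
  (forall x, unit_ball x -> forall v, nrm v <= 1 ->
     (1 - nrm x ^+ 2) * nrm ('d h x v) <= M) ->
  unit_ball z -> nrm (h z - h 0) <= M / (1 - nrm z ^+ 2).
Proof.
move=> hh hM z1; apply: mean_value_line => t t01.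
have tz1 := unit_ball_scale z1 t01; split; first exact: hh.
have := hM _ tz1 z (ltW z1); rewrite ler_pdivlMr ?one_sub_sqr_gt0 // [_ * (1 - nrm z ^+ 2)]mulrC.
apply: le_trans; rewrite ler_wpM2r ?nrm_ge0 // lerD2l lerN2 nrmZ nrm_real.
case/andP: t01 => t0 t1; rewrite ger0_norm // exprMn ler_piMl ?sqr_ge0 //.
by rewrite expr_le1.
Qed.

Variable ip : E -> E -> C.
Hypothesis ip_inner : is_inner_product ip.

Lemma diff_comp_mobius0 h b v : unit_ball b -> differentiable h b ->
  'd (h \o mobius ip b) 0 v = 'd h b (mobius_diff0 ip b v).
Proof.
move=> b1 hb.
have dh : is_diff (mobius ip b 0) h ('d h b).
  by rewrite mobius0 //; exact: differentiableP.
have di := is_diff_comp (is_diff_mobius0 ip_inner b1) dh.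
by rewrite diff_val.
Qed.

Lemma nrm_diff_mobius_le_inv_seminorm h b v : unit_ball b -> differentiable h b ->
  nrm v <= 1 -> ((nrm ('d h b (mobius_diff0 ip b v)))%:E <= inv_seminorm ip h)%E.
Proof.
move=> b1 hb v1.
rewrite -diff_comp_mobius0 //.
apply: (@le_trans _ _ (opnorm ('d (h \o mobius ip b) 0))).
  by apply: ereal_sup_ubound; exists v.
by apply: ereal_sup_ubound; exists b.
Qed.

Lemma inv_seminorm_ge0 h : analytic_on (@unit_ball R E) h -> (0 <= inv_seminorm ip h)%E.
Proof.
move=> hh; have u0 : @unit_ball R E 0 by rewrite /unit_ball /= nrm0.
apply: le_trans (nrm_diff_mobius_le_inv_seminorm u0 (hh _ u0) (v := 0) _).
  by rewrite lee_fin nrm_ge0.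
by rewrite nrm0.
Qed.

Lemma bloch_norm_at0 h (B : R) : analytic_on (@unit_ball R E) h ->
  (bloch_norm ip h <= B%:E)%E -> nrm (h 0) <= B.
Proof.
by move=> hh; apply: contraLR; rewrite -!ltNge => hB; rewrite -lte_fin in hB;
  apply: lt_le_trans hB _; rewrite leeDl ?inv_seminorm_ge0.
Qed.

(** Test the seminorm on the image of v / |v| under [mobius_lin ip x]: it has norm at most 1, and
    D_x sends it to -(1 - |x|^2) v / |v|. *)
Lemma bloch_norm_diff h (B : R) x v : analytic_on (@unit_ball R E) h ->
  (bloch_norm ip h <= B%:E)%E -> unit_ball x ->
  (1 - nrm x ^+ 2) * nrm ('d h x v) <= B * nrm v.
Proof.
move=> hh hB x1.
have [->|v0] := eqVneq v 0; first by rewrite linear0 !nrm0 !mulr0.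
have nv : 0 < nrm v by rewrite lt_neqAle nrm_ge0 eq_sym nrm_eq0 v0.
pose w := mobius_lin ip x (rC (nrm v)^-1 *: v).
have w1 : nrm w <= 1.
  apply: (le_trans (nrm_mobius_lin_le ip_inner _ x1)).
  by rewrite nrmZ nrm_real ger0_norm ?invr_ge0 ?nrm_ge0 // mulVf // gt_eqF.
have := le_trans (nrm_diff_mobius_le_inv_seminorm x1 (hh _ x1) w1)
  (le_trans (_ : (_ <= bloch_norm ip h)%E) hB).
rewrite lee_fin mobius_diff0_lin // linearZ linearZ /= !nrmZ nrmN !nrm_real.
rewrite sqr_mobius_s // !ger0_norm ?invr_ge0 ?nrm_ge0 // ?(ltW (one_sub_sqr_gt0 x1)) //.
rewrite mulrA mulrAC ler_pdivrMr //; apply.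
by rewrite leeDr // lee_fin nrm_ge0.
Qed.

Lemma bloch_norm_growth h (B : R) z : analytic_on (@unit_ball R E) h ->
  (bloch_norm ip h <= B%:E)%E -> unit_ball z ->
  nrm (h z) <= B * (1 + (1 - nrm z ^+ 2)^-1).
Proof.
move=> hh hB z1; rewrite -[h z](subrK (h 0)) (le_trans (nrmD _ _)) //.
rewrite mulrDr mulr1 addrC lerD ?(bloch_norm_at0 hh) //.
apply: bloch_growth => // x x1 v v1; apply: le_trans (bloch_norm_diff v hh hB x1) _.
by rewrite ler_piMr // (le_trans (nrm_ge0 _) (bloch_norm_at0 hh hB)).
Qed.

(** Trades the Moebius maps for the explicit operators D_b, with which the test functions are
    estimated. *)
Lemma bloch_norm_le h (K0 K : R) :
  analytic_on (@unit_ball R E) h -> nrm (h 0) <= K0 ->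
  (forall b v, unit_ball b -> nrm v <= 1 ->
    nrm ('d h b (mobius_diff0 ip b v)) <= K) ->
  (bloch_norm ip h <= (K0 + K)%:E)%E.
Proof.
move=> hh h0 hK; rewrite EFinD; apply: leeD; first by rewrite lee_fin.
apply: ge_ereal_sup => _ [b b1 <-]; apply: ge_ereal_sup => _ [v v1 <-].
by rewrite lee_fin diff_comp_mobius0 //; [exact: hK | exact: hh].
Qed.

Lemma bloch_bounded h (B : R) : analytic_on (@unit_ball R E) h ->
  (bloch_norm ip h <= B%:E)%E -> bloch h.
Proof.
move=> hh hB; split => //; exists B => x x1 v v1.
apply: le_trans (bloch_norm_diff v hh hB x1) _.
by rewrite ler_piMr // (le_trans (nrm_ge0 _) (bloch_norm_at0 hh hB)).
Qed.

End BlochSpace.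

(** * Test functions *)

Section TestFunctions.
Context {R : realType}.
Local Notation C := R[i].
Local Notation rC := (real_complex R).
Variable E : normedModType C.
Variable ip : E -> E -> C.
Hypothesis ip_inner : is_inner_product ip.
Implicit Types (x y z v w a b e : E).

(* Dividing by 11 puts these functions in the unit ball of the Bloch norm. *)
Definition test_fun a e (al : R) x : C^o :=
  rC (mobius_s a / 11) * ((rC al + ip x e) / (1 - ip x a)).

Lemma one_sub_nrm_ip_le x a : 1 - nrm (ip x a) <= nrm (1 - ip x a).
Proof.
by rewrite lerBlDr -[leLHS](@nrm1 R) -[X in nrm X <= _](subrK (ip x a)) nrmD.
Qed.

Lemma nrm_ip_ball x a : unit_ball a -> nrm (ip x a) <= nrm x.
Proof.
by move=> a1; rewrite (le_trans (nrm_ip_le ip_inner _ _)) // ler_piMr ?nrm_ge0 // ltW.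
Qed.

Lemma one_sub_ip_ge x a : unit_ball a -> 1 - nrm x <= nrm (1 - ip x a).
Proof.
by move=> a1; apply: le_trans (one_sub_nrm_ip_le x a); rewrite lerD2l lerN2 nrm_ip_ball.
Qed.

Lemma one_sub_ip_neq0 x a : unit_ball x -> unit_ball a -> 1 - ip x a != 0.
Proof.
move=> x1 a1; rewrite -nrm_eq0 gt_eqF // (lt_le_trans _ (one_sub_ip_ge x a1)) //.
by rewrite subr_gt0.
Qed.

Lemma is_diff_test_fun a e (al : R) x : unit_ball x -> unit_ball a ->
  is_diff x (test_fun a e al) (fun w => rC (mobius_s a / 11) *
    (ip w e / (1 - ip x a) + (rC al + ip x e) * ip w a / (1 - ip x a) ^+ 2) : C^o).
Proof.
move=> x1 a1; have n0 := one_sub_ip_neq0 x1 a1.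
have dk : is_diff x (fun y => 1 - ip y a : C^o) (fun y => - ip y a : C^o).
  have d1 := is_diff_cst (1 : C^o) x.
  apply: (is_diff_eq (is_diffB d1 (is_diff_ip ip_inner a x))).
  by rewrite funeqE => y /=; rewrite sub0r.
have dn : is_diff x (fun y => rC al + ip y e : C^o) (fun y => ip y e : C^o).
  have dal := is_diff_cst (rC al : C^o) x.
  apply: (is_diff_eq (is_diffD dal (is_diff_ip ip_inner e x))).
  by rewrite funeqE => y /=; rewrite add0r.
have dc := is_diff_cst (rC (mobius_s a / 11) : C^o) x.
apply: (is_diff_eq (is_diff_scale dc (is_diff_scale dn (is_diff_inv dk n0)))).
rewrite funeqE => w /=; rewrite scale0r addr0.
rewrite -[LHS]/(_ * (_ * _ + _ * _)).
by field.
Qed.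

Lemma test_fun_le a e (al : R) x : unit_ball x -> unit_ball a -> nrm e <= 1 ->
  0 <= al <= 1 -> nrm (test_fun a e al x) <= mobius_s a / (1 - nrm x).
Proof.
move=> x1 a1 e1 /andP[al0 al1].
have x2 : 0 < 1 - nrm x by rewrite subr_gt0.
have s0 := mobius_s_ge0 a.
rewrite /test_fun !nrmM nrmV nrm_real ger0_norm ?divr_ge0 //.
rewrite -mulrA ler_wpM2l // mulrA -[leRHS]mul1r.
(* The 11 absorbs |al + <x, e>| <= 2, and the denominator is at least 1 - |x|. *)
apply: ler_pM; rewrite ?mulr_ge0 ?invr_ge0 ?nrm_ge0 //.
  rewrite -ler_pdivlMl ?invr_gt0 // invrK mulr1.
  rewrite (le_trans (nrmD _ _)) // nrm_real ger0_norm //.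
  have : nrm (ip x e) <= 1 * 1.
    by rewrite (le_trans (nrm_ip_le ip_inner _ _)) // ler_pM ?nrm_ge0 // ltW.
  by move=> ?; lra.
rewrite lef_pV2 ?posrE // ?one_sub_ip_ge //.
exact: lt_le_trans x2 (one_sub_ip_ge x a1).
Qed.

(** Bessel's inequality for vectors that need not be normalised: expanding |b - <b, e> e - <b, a>
    a|^2 >= 0 produces the coefficients 2 - |e|^2 and 2 - |a|^2, both at least 1. *)
Lemma bessel2 b a e : nrm a <= 1 -> nrm e <= 1 -> ip a e = 0 ->
  nrm (ip b e) ^+ 2 + nrm (ip b a) ^+ 2 <= nrm b ^+ 2.
Proof.
move=> a1 e1 ae; have ea : ip e a = 0 by rewrite (ipC ip_inner) ae rmorph0.
have : nrm (b - (ip b e *: e + ip b a *: a)) ^+ 2 =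
   nrm b ^+ 2 - nrm (ip b e) ^+ 2 * (2 - nrm e ^+ 2) - nrm (ip b a) ^+ 2 * (2 - nrm a ^+ 2).
  have RE (p q r s t : R) : rC (p - q * (2 - s) - r * (2 - t)) =
     rC p - rC q * (2 - rC s) - rC r * (2 - rC t).
    by rewrite !(rmorphB, rmorphM) /= rmorphMn rmorph1.
  apply: complexI; rewrite {}RE -!(ipxx ip_inner) -!(ip_mulC ip_inner).
  rewrite !(ipDl ip_inner, ipDr ip_inner, ipNl ip_inner, ipNr ip_inner).
  rewrite !(ipDl ip_inner, ipDr ip_inner, ipZl ip_inner, ipZr ip_inner).
  rewrite -!(ipC ip_inner) ae ea; ring.
have e2 : nrm e ^+ 2 <= 1 by rewrite expr_le1 // nrm_ge0.
have a2 : nrm a ^+ 2 <= 1 by rewrite expr_le1 // nrm_ge0.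
have := sqr_ge0 (nrm (b - (ip b e *: e + ip b a *: a))).
have := sqr_ge0 (nrm (ip b e)); have := sqr_ge0 (nrm (ip b a)).
move: (nrm (ip b e) ^+ 2) (nrm (ip b a) ^+ 2) (nrm b ^+ 2) => p q r p0 q0 h0 h1.
rewrite h1 in h0; nra.
Qed.

Section Bound.
Variables (a e b v : E) (al : R).
Hypotheses (a1 : unit_ball a) (b1 : unit_ball b) (e1 : nrm e <= 1) (ae : ip a e = 0)
  (al0 : 0 <= al) (al_s : al <= mobius_s a) (v1 : nrm v <= 1).
Let D := nrm (1 - ip b a).

Let ipba1 : nrm (ip b a) <= nrm b * nrm a.
Proof. exact: nrm_ip_le. Qed.

(** From 2 |x| |y| <= 2 |x| <= 1 + |x|^2. *)
Let sqr_s_le x y : unit_ball x -> unit_ball y -> mobius_s x ^+ 2 <= 2 * (1 - nrm y * nrm x).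
Proof.
move=> x1 y1; rewrite sqr_mobius_s //.
have := nrm_ge0 x; have := nrm_ge0 y; move: x1 y1; rewrite /unit_ball /=; nra.
Qed.

Let sa : mobius_s a ^+ 2 <= 2 * D.
Proof.
rewrite (le_trans (sqr_s_le a1 b1)) // ler_wpM2l //.
by apply: le_trans (one_sub_nrm_ip_le b a); rewrite lerD2l lerN2.
Qed.

Let sb : mobius_s b ^+ 2 <= 2 * D.
Proof.
rewrite (le_trans (sqr_s_le b1 a1)) // ler_wpM2l // mulrC.
by apply: le_trans (one_sub_nrm_ip_le b a); rewrite lerD2l lerN2.
Qed.

Let sqr_one_sub : 1 - nrm (ip b a) ^+ 2 <= 2 * D.
Proof.
have := one_sub_nrm_ip_le b a; have := nrm_ge0 (ip b a); rewrite -/D.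
have : nrm (ip b a) <= 1.
  by apply: le_trans (nrm_ip_ball b a1) _; exact: ltW.
nra.
Qed.

(** Orthogonality of e and a enters here: Bessel gives |<b, e>|^2 <= 1 - |<b, a>|^2. *)
Let ip_e : nrm (ip b e) ^+ 2 <= 2 * D.
Proof.
apply: le_trans sqr_one_sub; rewrite lerBrDr (le_trans (bessel2 b (ltW a1) e1 ae)) //.
by rewrite expr_le1 ?nrm_ge0 // ltW.
Qed.

(** Moving D_b onto a by self-adjointness leaves |D_b a|^2 = (1 - |b|^2) (|a|^2 - |<a, b>|^2), where
    each factor is at most 2 D. *)
Let ip_diff0_a : nrm (ip (mobius_diff0 ip b v) a) <= 2 * D.
Proof.
rewrite mobius_diff0_adj // (le_trans (nrm_ip_le ip_inner _ _)) //.
apply: (@le_trans _ _ (1 * nrm (mobius_diff0 ip b a))); first by rewrite ler_wpM2r ?nrm_ge0.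
rewrite mul1r -ler_sqr ?nnegrE ?mulr_ge0 ?nrm_ge0 //.
rewrite nrm_mobius_diff0 // -sqr_mobius_s // expr2 ler_pM ?sqr_ge0 //.
  rewrite subr_ge0 ler_sqr ?nnegrE ?nrm_ge0 //; exact: nrm_ip_ball.
apply: le_trans sqr_one_sub; rewrite nrm_ipC //.
by rewrite lerD2r expr_le1 ?nrm_ge0 // ltW.
Qed.

Let ip_diff0_e : nrm (ip (mobius_diff0 ip b v) e) <= mobius_s b.
Proof.
rewrite (le_trans (nrm_ip_le ip_inner _ _)) //.
rewrite -[leRHS]mulr1 ler_pM ?nrm_ge0 // (le_trans (nrm_mobius_diff0_le ip_inner _ b1)) //.
by rewrite ler_piMr ?mobius_s_ge0.
Qed.

(** In the quotient rule, one factor of 1 / D^2 is paid for by |<D_b v, a>| <= 2 D. What remains is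
    s_a (s_b + 2 (al + |<b, e>|)) / (11 D), and each product with s_a is at most 2 D: in total (2 +
    4 + 4) / 11. *)
Lemma diff_test_fun_le :
  nrm ('d (test_fun a e al) b (mobius_diff0 ip b v)) <= 10 / 11.
Proof.
have dF := is_diff_test_fun e al b1 a1.
rewrite diff_val /=.
have D0 : 0 < D by rewrite lt_neqAle nrm_ge0 eq_sym nrm_eq0 one_sub_ip_neq0.
have s0 := mobius_s_ge0 a; have s0' := mobius_s_ge0 b.
rewrite nrmM nrm_real ger0_norm ?divr_ge0 //.
have ipe := ip_e; set q := nrm (ip b e) in ipe *.
have q0 : 0 <= q := nrm_ge0 _.
have : nrm (ip (mobius_diff0 ip b v) e / (1 - ip b a) +
    (rC al + ip b e) * ip (mobius_diff0 ip b v) a / (1 - ip b a) ^+ 2)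
   <= (mobius_s b + 2 * (al + q)) / D.
  rewrite (le_trans (nrmD _ _)) // [leRHS]mulrDl; apply: lerD.
    by rewrite nrmM nrmV -/D ler_wpM2r ?invr_ge0 ?nrm_ge0.
  rewrite nrmM nrmV expr2 !nrmM -/D.
  have -> : 2 * (al + q) / D = (al + q) * (2 * D) / (D * D).
    by field; rewrite gt_eqF.
  rewrite ler_wpM2r ?invr_ge0 ?mulr_ge0 ?nrm_ge0 //.
  rewrite ler_pM ?nrm_ge0 // (le_trans (nrmD _ _)) // nrm_real ger0_norm //.
move=> h; apply: (le_trans (ler_wpM2l (divr_ge0 s0 (ler0n _ 11)) h)).
rewrite mulrA ler_pdivrMr //.
have := sa; have := sb; move: ipe; rewrite -/D.
clear h; move: s0 s0' q0 al0 al_s; move: (mobius_s a) (mobius_s b) q D => s t q' d.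
move=> s0 t0 q0 r0 rs qd td sd.
(* Arithmetic-geometric mean: s and y both have square at most 2 d. *)
have sq (y : R) : y ^+ 2 <= 2 * d -> s * y <= 2 * d.
  by move=> yd; have := sqr_ge0 (s - y); nra.
have r2 : al ^+ 2 <= 2 * d by apply: le_trans sd; rewrite ler_sqr.
by have := sq _ td; have := sq _ qd; have := sq _ r2; lra.
Qed.

End Bound.

Lemma test_fun0_le a e (al : R) : unit_ball a -> 0 <= al <= 1 ->
  nrm (test_fun a e al 0) <= 11^-1.
Proof.
move=> a1 /andP[al0 al1].
rewrite /test_fun !(ip0l ip_inner) addr0 subr0 invr1 mulr1 nrmM !nrm_real.
have s0 := mobius_s_ge0 a; have s1 := mobius_s_le1 a.
rewrite !ger0_norm ?divr_ge0 // -[leRHS]mulr1 ler_pM ?divr_ge0 //.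
by rewrite ler_piMl.
Qed.

Lemma analytic_test_fun a e (al : R) : unit_ball a ->
  analytic_on (@unit_ball R E) (test_fun a e al).
Proof. by move=> a1 x x1; have [] := is_diff_test_fun e al x1 a1. Qed.

Lemma bloch_norm_test_fun a e (al : R) : unit_ball a -> nrm e <= 1 ->
  ip a e = 0 -> 0 <= al <= mobius_s a ->
  (bloch_norm ip (test_fun a e al) <= 1%:E)%E.
Proof.
move=> a1 e1 ae /andP[al0 als].
(* A share of 1/11 for the value at 0, 10/11 for the seminorm. *)
have -> : (1 : R) = 11^-1 + 10 / 11 by field.
apply: (bloch_norm_le ip_inner).
- exact: analytic_test_fun.
- by apply: test_fun0_le => //; rewrite al0 (le_trans als) // mobius_s_le1.
- by move=> b v b1 v1; exact: diff_test_fun_le.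
Qed.

(** At a the denominator 1 - <a, a> is s_a^2. Thus e = 0, al = s_a yields <v, a> / (11 s_a^2), and
    al = 0 yields <v, e> / (11 s_a). *)
Lemma diff_test_fun_self a e (al : R) v : unit_ball a -> ip a e = 0 ->
  'd (test_fun a e al) a v =
   rC (11^-1 / mobius_s a) * (ip v e + rC (al / mobius_s a ^+ 2) * ip v a).
Proof.
move=> a1 ae; have dF := is_diff_test_fun e al a1 a1.
rewrite diff_val /= ae addr0 (ipxx ip_inner).
have -> : 1 - rC (nrm a ^+ 2) = rC (mobius_s a) ^+ 2.
  by rewrite -rmorphXn sqr_mobius_s // rmorphB rmorph1.
have s0 : rC (mobius_s a) != 0.
  by rewrite (inj_eq (@complexI R) _ 0) gt_eqF // mobius_s_gt0.
have e11 : rC 11 = 11 by rewrite rmorph_nat.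
by rewrite !rmorphM !fmorphV rmorphXn /= e11; field; rewrite s0.
Qed.

End TestFunctions.

(** * Compactness of the composition operator *)

Section CompactCompositionOperator.
Context {R : realType}.
Local Notation C := R[i].
Local Notation rC := (real_complex R).
Variable E : normedModType C.
Variable ip : E -> E -> C.
Hypothesis ip_inner : is_inner_product ip.
Variable phi : E -> E.
Hypothesis phi_ball : forall z, @unit_ball R E z -> @unit_ball R E (phi z).
Hypothesis phi_analytic : analytic_on (@unit_ball R E) phi.
Hypothesis Cphi_compact : compact_comp_op ip phi.
Implicit Types (x y z v w a b e : E) (u : nat -> E -> C^o).

(** Needed because the limit function in the next lemmas is only known to vanish on the open
    ball. *)
Lemma near_eq_diff (f g : E -> C^o) x v : differentiable f x -> differentiable g x ->
  (\near x, f x = g x) -> 'd f x v = 'd g x v.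
Proof.
move=> df dg fg.
have e1 := deriveE v df.
have e2 := deriveE v dg.
have e3 := near_eq_derive v fg.
exact: etrans (etrans (esym e1) e3) e2.
Qed.

Lemma compact_comp_subseq u :
  (forall n, bloch (u n) /\ (bloch_norm ip (u n) <= 1)%E) ->
  exists (sigma : nat -> nat) (g : E -> C^o),
    [/\ forall n, (n <= sigma n)%N, analytic_on (@unit_ball R E) g,
      forall k, analytic_on (@unit_ball R E) (u (sigma k) \o phi - g) &
      forall eps : R, 0 < eps -> exists K, forall k, (K <= k)%N ->
        (bloch_norm ip (u (sigma k) \o phi - g)%R <= eps%:E)%E].
Proof.
move=> u_bloch; have [Cphi_bloch /(_ u u_bloch) [sigma [g [sigma_homo [g_bloch cv]]]]] :=
  Cphi_compact.
exists sigma, g; split.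
- elim=> // n IHn; exact: leq_ltn_trans IHn (sigma_homo _ _ (ltnSn n)).
- by case: g_bloch.
- move=> k x x1; apply: differentiableB; last by case: g_bloch => + _; apply.
  by have [+ _] := Cphi_bloch _ (u_bloch (sigma k)).1; apply.
- move=> eps eps0; have : nbhs (0 : \bar R)%E [set x | (x < eps%:E)%E].
    by apply: open_ereal_lt'; rewrite lte_fin.
  by move/cv => [K _ hK]; exists K => k Kk; apply: ltW; exact: hK.
Qed.

(** Bloch convergence implies pointwise convergence on the ball, so the limit of the subsequence
    vanishes there. One index n is produced for all z at once, so z may later depend on n. *)
Lemma compact_comp_null u :
  (forall n, bloch (u n) /\ (bloch_norm ip (u n) <= 1)%E) ->
  (forall x, unit_ball x -> forall eps : R, 0 < eps ->
    exists N, forall n, (N <= n)%N -> nrm (u n x) <= eps) ->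
  forall eps : R, 0 < eps -> exists n, forall z v, unit_ball z ->
    (1 - nrm z ^+ 2) * nrm ('d (u n \o phi) z v) <= eps * nrm v.
Proof.
move=> u_bloch u0; have [sigma [g [sigma_ge g_an h_an cv]]] := compact_comp_subseq u_bloch.
have g0 z : unit_ball z -> g z = 0.
  move=> z1; apply/eqP; rewrite -nrm_eq0 -[_ == _]negbK; apply/negP => gz0.
  have gz : 0 < nrm (g z) by rewrite lt_neqAle eq_sym gz0 nrm_ge0.
  (* The growth factor of [bloch_norm_growth] at z. Both terms bounding |g z| below are then at most
     |g z| / 4, a contradiction. *)
  set c := 1 + (1 - nrm z ^+ 2)^-1.
  have c0 : 0 < c by rewrite ltr_wpDr ?invr_ge0 ?ltW ?one_sub_sqr_gt0.
  have [K hK] := cv (nrm (g z) / (4 * c)) (divr_gt0 gz (mulr_gt0 (ltr0n _ 4) c0)).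
  have [N hN] := u0 _ (phi_ball z1) (nrm (g z) / 4) (divr_gt0 gz (ltr0n _ 4)).
  pose k := maxn K N.
  have h1 := bloch_norm_growth ip_inner (h_an k) (hK k (leq_maxl _ _)) z1.
  have h2 := hN (sigma k) (leq_trans (leq_maxr K N) (sigma_ge k)).
  have h3 : nrm (g z) <= nrm ((u (sigma k) \o phi - g) z) + nrm (u (sigma k) (phi z)).
    have -> : g z = u (sigma k) (phi z) - (u (sigma k) \o phi - g) z.
      by rewrite /= opprB addrC subrK.
    by rewrite [leRHS]addrC nrmB.
  have : nrm (g z) / (4 * c) * c = nrm (g z) / 4 by field; rewrite gt_eqF.
  rewrite -/c in h1; lra.
move=> eps eps0; have [K hK] := cv eps eps0.
exists (sigma K) => z v z1.
have h_K := h_an K; have g_z := g_an z z1.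
have -> : 'd (u (sigma K) \o phi) z v = 'd (u (sigma K) \o phi - g) z v.
  apply: near_eq_diff.
  - by have [+ _] := Cphi_compact.1 _ (u_bloch (sigma K)).1; apply.
  - exact: h_K.
  apply: filterS (unit_ball_near z1) => y y1.
  have -> : (u (sigma K) \o phi - g) y = u (sigma K) (phi y) - g y by [].
  by rewrite g0 ?subr0.
exact: (bloch_norm_diff ip_inner v h_K (hK K (leqnn K)) z1).
Qed.

(** If every r = 1 - 1/(n+1) fails, the offending z, e, al define test functions that tend to 0
    pointwise, since s_a tends to 0 for a = phi(z). The bound is uniform in e and al, which may
    therefore be chosen after z. *)
Lemma test_fun_vanish (eps : R) : 0 < eps -> exists r : R, r < 1 /\
  forall z, unit_ball z -> r < nrm (phi z) -> forall e (al : R),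
    nrm e <= 1 -> ip (phi z) e = 0 -> 0 <= al <= mobius_s (phi z) ->
    (1 - nrm z ^+ 2) * nrm (ip (radial_der phi z) e +
        rC (al / mobius_s (phi z) ^+ 2) * ip (radial_der phi z) (phi z))
      / mobius_s (phi z) <= eps.
Proof.
move=> eps0; apply: contrapT => /forallNP H.
have {}H (n : nat) : exists p : E * E * R, let: (z, e, al) := p in
    [/\ unit_ball z, 1 - n.+1%:R^-1 < nrm (phi z),
      [/\ nrm e <= 1, ip (phi z) e = 0 & 0 <= al <= mobius_s (phi z)] &
     eps < (1 - nrm z ^+ 2) * nrm (ip (radial_der phi z) e +
        rC (al / mobius_s (phi z) ^+ 2) * ip (radial_der phi z) (phi z))
      / mobius_s (phi z)].
  apply: contrapT => /forallNP Hn; apply: (H (1 - n.+1%:R^-1)); split.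
    by rewrite gtrBl invr_gt0.
  move=> z z1 zr e al e1 ze alz; rewrite leNgt; apply/negP => lt_eps.
  by apply: (Hn (z, e, al)).
have [p /= hp] := choice H.
pose z n := (p n).1.1; pose e n := (p n).1.2; pose al n := (p n).2.
have {}hp n : [/\ unit_ball (z n), 1 - n.+1%:R^-1 < nrm (phi (z n)),
      [/\ nrm (e n) <= 1, ip (phi (z n)) (e n) = 0 & 0 <= al n <= mobius_s (phi (z n))] &
     eps < (1 - nrm (z n) ^+ 2) * nrm (ip (radial_der phi (z n)) (e n) +
        rC (al n / mobius_s (phi (z n)) ^+ 2) * ip (radial_der phi (z n)) (phi (z n)))
      / mobius_s (phi (z n))].
  by move: (hp n); rewrite /z /e /al; case: (p n) => [[? ?] ?].
pose u n := test_fun ip (phi (z n)) (e n) (al n).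
have eps1 : 0 < eps / 11 by rewrite divr_gt0.
have [||n] := @compact_comp_null u _ _ (eps / 11) eps1.
- move=> n; have [z1 _ [e1 ze alz] _] := hp n.
  have b1 := bloch_norm_test_fun ip_inner (phi_ball z1) e1 ze alz.
  split => //; apply: (bloch_bounded ip_inner) b1; apply: analytic_test_fun => //.
  exact: phi_ball.
- move=> x x1 d d0.
  have x2 : 0 < 1 - nrm x by rewrite subr_gt0.
  (* Chosen so that 1 - |a| < t forces s_a^2 <= 2 (1 - |a|) <= (d (1 - |x|))^2. *)
  set t := (d * (1 - nrm x)) ^+ 2 / 2.
  have t0 : 0 < t by rewrite divr_gt0 ?exprn_gt0 ?mulr_gt0.
  have [N _ hN] := near_infty_natSinv_lt (PosNum t0).
  exists N => n Nn; have [z1 zr [e1 ze /andP[al0 als]] _] := hp n.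
  have a1 := phi_ball z1.
  apply: le_trans (test_fun_le ip_inner x1 a1 e1 _) _.
    by rewrite al0 (le_trans als) // mobius_s_le1.
  rewrite ler_pdivrMr // -ler_sqr ?nnegrE ?mobius_s_ge0 ?mulr_ge0 ?(ltW d0) ?(ltW x2) //.
  rewrite sqr_mobius_s //.
  have := hN n Nn; rewrite /=.
  rewrite -[(d * _) ^+ 2](divfK (_ : 2 != 0)) // -/t.
  move: zr (nrm_ge0 (phi (z n))) a1; rewrite /unit_ball /=.
  move: (nrm _) (n.+1%:R^-1) => m i im m0 m1 it.
  have : (1 - m) * (1 + m) <= (1 - m) * 2 by rewrite ler_wpM2l //; lra.
  by lra.
move=> hn; have [z1 _ [e1 ze alz]] := hp n.
have a1 := phi_ball z1; have s0 := mobius_s_gt0 a1.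
(* The direction is the point itself, which produces the radial derivative. *)
have := hn (z n) (z n) z1.
rewrite diff_comp; [|exact: phi_analytic|exact: analytic_test_fun].
rewrite /= diff_test_fun_self // nrmM nrm_real.
rewrite ger0_norm ?divr_ge0 ?invr_ge0 ?mobius_s_ge0 // => h.
rewrite ltNge => /negP; apply.
have : eps / 11 * nrm (z n) <= eps / 11 by rewrite ler_piMr // ltW.
move/(le_trans h); rewrite /radial_der; set q := nrm (_ + _); lra.
Qed.

End CompactCompositionOperator.

(** * Relative compactness of the image *)

Section TotallyBounded.
Context {R : realType}.
Local Notation C := R[i].
Local Notation rC := (real_complex R).

(** Otherwise a point far from all those already chosen can always be added, and the greedy sequence
    has no close pair. *)
Lemma finite_net (T : Type) (P : T -> Prop) (close : T -> T -> Prop) (x0 : T) :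
  (forall u : nat -> T, (forall n, P (u n)) ->
     exists m n, (m < n)%N /\ close (u m) (u n)) ->
  exists (N : nat) (f : nat -> T), (forall i, (i < N)%N -> P (f i)) /\
    forall x, P x -> exists2 i, (i < N)%N & close (f i) x.
Proof.
move=> seq_close; apply: contrapT => noN.
have far (p : nat * (nat -> T)) : exists x, (forall i, (i < p.1)%N -> P (p.2 i)) ->
    P x /\ forall i, (i < p.1)%N -> ~ close (p.2 i) x.
  apply: contrapT => /forallNP nox; apply: noN; exists p.1, p.2.
  split=> [|x Px].
    (* If a listed point violates P, the default [x0] qualifies vacuously. *)
    by apply: contrapT => h; apply: (nox x0) => /h.
  apply: contrapT => h; apply: (nox x) => _; split => // i ip ci.
  by apply: h; exists i.
have [G hG] := choice far.
(* Course-of-values recursion: [L n] lists the first n choices. *)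
pose L := fix L n := if n is n'.+1 then rcons (L n') (G (n', nth x0 (L n'))) else [::].
pose u n := G (n, nth x0 (L n)).
have szL n : size (L n) = n by elim: n => //= n IHn; rewrite size_rcons IHn.
have nthL n i : (i < n)%N -> nth x0 (L n) i = u i.
  elim: n => // n IHn; rewrite ltnS leq_eqVlt /= nth_rcons szL.
  by case/orP => [/eqP->|i_n]; rewrite ?ltnn ?eqxx // i_n IHn.
have Pu n : P (u n) /\ forall i, (i < n)%N -> ~ close (u i) (u n).
  have [m] := ubnP n; elim: m n => // m IHm n nm.
  have [/= i i_n|Pn far_n] := hG (n, nth x0 (L n)).
    by rewrite nthL //; apply: (IHm i _).1; exact: leq_trans i_n nm.
  by split=> // i i_n; have := far_n i i_n; rewrite /= nthL.
have [m [n [mn]]] := seq_close u (fun n => (Pu n).1).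
exact: (Pu n).2.
Qed.

(** Colour x by the cell of length eps containing f x + M. Finite colourings encode total
    boundedness without centres, and several of them combine by taking products. *)
Lemma real_coloring (X : Type) (A : set X) (f : X -> R) (M eps : R) : 0 < eps ->
  (forall x, A x -> `|f x| <= M) ->
  exists (T : finType) (c : X -> T), forall x y, A x -> A y -> c x = c y ->
    `|f x - f y| < eps.
Proof.
move=> eps0 fM; pose N := Num.truncn ((M + M) / eps).
pose k x := Num.truncn ((f x + M) / eps).
(* [inord] loses nothing on A, where k x <= N; elsewhere the colour is irrelevant. *)
exists 'I_N.+1, (fun x => inord (k x)).
have f0 x : A x -> 0 <= f x + M.
  by move=> /fM; rewrite ler_norml => /andP[h _]; rewrite -lerBlDr sub0r.
have kN x : A x -> (k x < N.+1)%N.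
  move=> Ax; rewrite ltnS; apply: le_truncn.
  by rewrite ler_pM2r ?invr_gt0 // lerD2r (le_trans (ler_norm _)) // fM.
move=> x y Ax Ay /(congr1 val) /=; rewrite !inordK ?kN // => kxy.
have itv z : A z -> (k z)%:R * eps <= f z + M < (k z).+1%:R * eps.
  move=> Az; rewrite -ler_pdivlMr // -ltr_pdivrMr //.
  by apply: truncn_itv; rewrite divr_ge0 ?f0 // ltW.
have := itv x Ax; have := itv y Ay; rewrite kxy -natr1 ltr_norml.
by move: (k y)%:R => t /andP[? ?] /andP[? ?]; apply/andP; split; lra.
Qed.

Lemma complex_coloring (X : Type) (A : set X) (f : X -> C) (M eps : R) : 0 < eps ->
  (forall x, A x -> nrm (f x) <= M) ->
  exists (T : finType) (c : X -> T), forall x y, A x -> A y -> c x = c y ->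
    nrm (f x - f y) < eps.
Proof.
move=> eps0 fM; have eps2 : 0 < eps / 2 by rewrite divr_gt0.
have [|T1 [c1 h1]] := @real_coloring X A (fun x => complex.Re (f x)) M _ eps2.
  by move=> x Ax; rewrite (le_trans (ler_Re_nrm _)) // fM.
have [|T2 [c2 h2]] := @real_coloring X A (fun x => complex.Im (f x)) M _ eps2.
  by move=> x Ax; rewrite (le_trans (ler_Im_nrm _)) // fM.
exists (T1 * T2)%type, (fun x => (c1 x, c2 x)) => x y Ax Ay [c1xy c2xy].
apply: (le_lt_trans (ler_nrm_ReIm _)).
have := h1 x y Ax Ay c1xy; have := h2 x y Ax Ay c2xy.
by case: (f x) (f y) => [? ?] [? ?] /= ? ?; lra.
Qed.

Lemma finite_coloring (X : Type) (A : set X) (f : nat -> X -> C) (N : nat) (eps : R) :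
  0 < eps ->
  (forall i, (i < N)%N -> exists M : R, forall x, A x -> nrm (f i x) <= M) ->
  exists (T : finType) (c : X -> T), forall x y, A x -> A y -> c x = c y ->
    forall i, (i < N)%N -> nrm (f i x - f i y) < eps.
Proof.
move=> eps0; elim: N => [|N IHN] fM; first by exists unit, (fun=> tt).
have [i iN|T1 [c1 h1]] := IHN; first by apply: fM; exact: ltnW.
have [M /(complex_coloring eps0) [T2 [c2 h2]]] := fM N (ltnSn N).
exists (T1 * T2)%type, (fun x => (c1 x, c2 x)) => x y Ax Ay [c1xy c2xy] i.
rewrite ltnS leq_eqVlt => /orP[/eqP->|]; [exact: h2 | exact: h1].
Qed.

(** An ultrafilter on the closure contains one of finitely many small sets for each eps, hence is
    Cauchy and converges by completeness. *)
Lemma compact_closure_coloring (E : completeNormedModType C) (A : set E) :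
  (forall eps : R, 0 < eps -> exists (T : finType) (c : E -> T),
    forall x y, A x -> A y -> c x = c y -> nrm (x - y) < eps) ->
  compact (closure A).
Proof.
move=> tbA; rewrite compact_ultra => F UF FA.
have cF : cauchy F.
  apply: cauchy_exP => eps eps0.
  have e0 : 0 < complex.Re eps / 3.
    by rewrite divr_gt0 // -ltcR RRe_real ?gtr0_real.
  have [T [c hc]] := tbA _ e0.
  (* The colour classes are thickened because the ultrafilter lives on the closure of A, not on
     A. *)
  pose B t := [set x : E | exists y, [/\ A y, c y = t & nrm (x - y) < complex.Re eps / 3]].
  have [t Bt] : exists t, F (B t).
    apply: contrapT => /forallNP nB.
    (* All complements would lie in F, hence also their finite intersection, which misses the
       closure of A. *)
    have nF t : F (~` B t) by have [/nB|] := in_ultra_setVsetC (B t) UF.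
    have FB : F [set x | forall t, (~` B t) x] by apply: filter_forall nF.
    have [x [xA xB]] := filter_ex (filterI FA FB).
    have [|y [Ay xy]] := xA (ball x (rC (complex.Re eps / 3))).
      by apply: nbhsx_ballx; rewrite ltcR.
    apply: (xB (c y)); exists y; split=> //.
    by move: xy; rewrite -ball_normE /= nrmE ltcR.
  have [x [y [Ay yt xy]]] := filter_ex Bt.
  exists x; apply: filterS Bt => x' [y' [Ay' yt' xy']].
  rewrite -ball_normE /= nrmE -[eps]RRe_real ?gtr0_real // ltcR.
  have yy' := hc y y' Ay Ay' (etrans yt (esym yt')).
  have -> : x - x' = (x - y) + (y - y') - (x' - y').
    by rewrite opprB [x - y + _]addrA subrK addrA subrK.
  have := nrmB (x - y + (y - y')) (x' - y'); have := nrmD (x - y) (y - y').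
  rewrite /=; lra.
have Fp : F --> lim F by apply: cauchy_cvg.
exists (lim F); split=> //.
rewrite [closure A](closure_id _).1; last exact: closed_closure.
move=> B Bp; have FB : F B := Fp _ Bp.
exact: filter_ex (filterI FA FB).
Qed.

End TotallyBounded.

Section RelativelyCompactImage.
Context {R : realType}.
Local Notation C := R[i].
Local Notation rC := (real_complex R).
Variable E : completeNormedModType C.
Variable ip : E -> E -> C.
Hypothesis ip_inner : is_inner_product ip.
Variable phi : E -> E.
Hypothesis Cphi_compact : compact_comp_op ip phi.

Lemma bloch_norm_ip (e : E) : nrm e <= 1 ->
  bloch (ip^~ e : E -> C^o) /\ (bloch_norm ip (ip^~ e : E -> C^o) <= 1%:E)%E.
Proof.
move=> e1.
have an : analytic_on (@unit_ball R E) (ip^~ e : E -> C^o).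
  by move=> x _; have [] := is_diff_ip ip_inner e x.
have b1 : (bloch_norm ip (ip^~ e : E -> C^o) <= 1%:E)%E.
  rewrite -[1 in leRHS]add0r; apply: (bloch_norm_le ip_inner) => //.
    by rewrite (ip0l ip_inner) nrm0.
  move=> b v b1 v1; have de := is_diff_ip ip_inner e b.
  rewrite diff_val (le_trans (nrm_ip_le ip_inner _ _)) // -[leRHS]mulr1.
  rewrite ler_pM ?nrm_ge0 // (le_trans (nrm_mobius_diff0_le ip_inner _ b1)) //.
  rewrite -[leRHS]mulr1 ler_pM ?nrm_ge0 ?mobius_s_ge0 //; exact: mobius_s_le1.
by split => //; exact: bloch_bounded b1.
Qed.

(* By compactness, finitely many [f i \o phi] approximate all [f \o phi], [f] in the
   Bloch unit ball, uniformly on [delta B]. So two points of [phi (delta B)] at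
   which the [f i] nearly agree are close: test with the functional [ip^~ e]
   norming their difference. *)
Lemma compact_image_scaled_ball (delta : R) : 0 < delta < 1 ->
  compact (closure (phi @` [set rC delta *: x | x in @unit_ball R E])).
Proof.
move=> /andP[d0 d1]; set S := [set rC delta *: x | x in @unit_ball R E].
have S_ball z : S z -> unit_ball z /\ nrm z <= delta.
  move=> [x x1 <-]; split; first by apply: unit_ball_scale => //; rewrite !ltW.
  by rewrite nrmZ nrm_real gtr0_norm // ler_piMr // ltW.
pose c := 1 + (1 - delta ^+ 2)^-1.
have d2 : 0 < 1 - delta ^+ 2 by rewrite subr_gt0 expr_lt1 // ltW.
have c0 : 0 < c by rewrite ltr_wpDr // invr_ge0 ltW.
have inv_le z : S z -> (1 - nrm z ^+ 2)^-1 <= (1 - delta ^+ 2)^-1.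
  move=> /S_ball [z1 zd]; rewrite lef_pV2 ?posrE ?one_sub_sqr_gt0 //.
  by rewrite lerD2l lerN2 ler_sqr ?nnegrE ?nrm_ge0 // ltW.
apply: compact_closure_coloring => eps eps0.
have eps4 : 0 < eps / 4 by rewrite divr_gt0.
pose P (f : E -> C^o) := bloch f /\ (bloch_norm ip f <= 1)%E.
pose close (f g : E -> C^o) := forall z, S z -> nrm (f (phi z) - g (phi z)) <= eps / 4.
have [u Pu|N [f [Pf net]]] := @finite_net _ P close (fun=> 0).
  have [sigma [g [sigma_ge g_an h_an cv]]] := compact_comp_subseq Cphi_compact Pu.
  (* The growth factor on S is at most c, so Bloch distance eps / (8 c) becomes eps / 8 on S, and
     two terms of the tail differ there by at most eps / 4. *)
  have eta0 : 0 < eps / (8 * c) by rewrite divr_gt0 ?mulr_gt0.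
  have [K hK] := cv _ eta0.
  (* This k is in the tail and satisfies sigma K < k <= sigma k. *)
  pose k := maxn K (sigma K).+1.
  exists (sigma K), (sigma k); split.
    exact: leq_trans (leq_maxr K _) (sigma_ge k).
  move=> z Sz; have [z1 _] := S_ball z Sz.
  have growth j : (K <= j)%N ->
      nrm ((u (sigma j) \o phi - g) z) <= eps / 8.
    move=> Kj; apply: (le_trans (bloch_norm_growth ip_inner (h_an j) (hK j Kj) z1)).
    have -> : eps / 8 = eps / (8 * c) * c by field; rewrite gt_eqF.
    by rewrite ler_wpM2l ?(ltW eta0) // lerD2l inv_le.
  have -> : u (sigma K) (phi z) - u (sigma k) (phi z) =
      (u (sigma K) \o phi - g) z - (u (sigma k) \o phi - g) z.
    by rewrite /= opprB addrA subrK.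
  have := growth K (leqnn K); have := growth k (leq_maxl _ _).
  have := nrmB ((u (sigma K) \o phi - g) z) ((u (sigma k) \o phi - g) z).
  lra.
(* Each f i is bounded on phi(S) because f i o phi is a Bloch function, to which the growth estimate
   applies on S. *)
have [i iN|T [col hcol]] := @finite_coloring R E (phi @` S) f N _ eps4.
  have [Cphi_bloch _] := Cphi_compact.
  have [h_an [M hM]] := Cphi_bloch _ (Pf i iN).1.
  exists (nrm ((f i \o phi) 0) + `|M| * (1 - delta ^+ 2)^-1) => _ [z Sz <-].
  have [z1 _] := S_ball z Sz.
  rewrite -[f i (phi z)](subrK ((f i \o phi) 0)) addrC.
  apply: (le_trans (nrmD _ _)); rewrite lerD2l.
  apply: (le_trans (bloch_growth h_an hM z1)).
  apply: (@le_trans _ _ (`|M| / (1 - nrm z ^+ 2))).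
    by rewrite ler_wpM2r ?ler_norm // invr_ge0 ltW ?one_sub_sqr_gt0.
  by rewrite ler_wpM2l ?inv_le.
exists T, col => x y Ax Ay /(hcol x y Ax Ay) fxy.
have [->|xy] := eqVneq x y; first by rewrite subrr nrm0.
have nxy : 0 < nrm (x - y) by rewrite lt_neqAle nrm_ge0 eq_sym nrm_eq0 subr_eq0 xy.
pose e := rC (nrm (x - y))^-1 *: (x - y).
have e1 : nrm e <= 1.
  by rewrite nrmZ nrm_real gtr0_norm ?invr_gt0 // mulVf // gt_eqF.
have [i iN fie] := net _ (bloch_norm_ip e1).
have ipe : nrm (x - y) = nrm (ip x e - ip y e).
  rewrite -(ipBl ip_inner) /e (ipZr ip_inner) conj_rC (ipxx ip_inner) -rmorphM nrm_real.
  by rewrite expr2 mulrA mulVf ?gt_eqF // mul1r gtr0_norm.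
rewrite ipe.
have fx : nrm (f i x - ip x e) <= eps / 4 by case: Ax => z Sz <-; exact: fie.
have fy : nrm (f i y - ip y e) <= eps / 4 by case: Ay => z Sz <-; exact: fie.
have -> : ip x e - ip y e = (f i x - f i y) - (f i x - ip x e) + (f i y - ip y e).
  by ring.
have := fxy i iN.
have := nrmD ((f i x - f i y) - (f i x - ip x e)) (f i y - ip y e).
have := nrmB (f i x - f i y) (f i x - ip x e).
lra.
Qed.

End RelativelyCompactImage.

(** * Boundary limits *)

Section BoundaryLimits.
Context {R : realType}.
Local Notation C := R[i].
Local Notation rC := (real_complex R).
Variable E : normedModType C.
Variable ip : E -> E -> C.
Hypothesis ip_inner : is_inner_product ip.
Variable phi : E -> E.
Hypothesis phi_ball : forall z, @unit_ball R E z -> @unit_ball R E (phi z).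
Hypothesis phi_analytic : analytic_on (@unit_ball R E) phi.
Hypothesis Cphi_compact : compact_comp_op ip phi.

(** The case e = 0, al = s_a of [test_fun_vanish]; halving eps makes the inequality strict. *)
Lemma radial_der_tangential_lim (eps : R) : 0 < eps -> exists r : R, r < 1 /\
  forall z, unit_ball z -> r < nrm (phi z) ->
    (1 - nrm z ^+ 2) * nrm (ip (phi z) (radial_der phi z))
      / (1 - nrm (phi z) ^+ 2) < eps.
Proof.
move=> eps0; have eps2 : 0 < eps / 2 by rewrite divr_gt0.
have [r [r1 hr]] := test_fun_vanish ip_inner phi_ball phi_analytic Cphi_compact eps2.
exists r; split=> // z z1 rz; have a1 := phi_ball z1; have s0 := mobius_s_gt0 a1.
have := hr z z1 rz 0 (mobius_s (phi z)); rewrite nrm0 !(ip0r ip_inner) add0r.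
rewrite ler01 lexx ltW // nrmM nrm_real (nrm_ipC ip_inner (phi z)).
rewrite ger0_norm ?divr_ge0 ?sqr_ge0 ?(ltW s0) // => /(_ isT erefl isT).
rewrite -(sqr_mobius_s a1); set s := mobius_s _ in s0 *.
set q := nrm (ip _ _); set d := 1 - _ => h.
have -> : d * q / s ^+ 2 = d * (s / s ^+ 2 * q) / s by field; rewrite gt_eqF.
by apply: le_lt_trans h _; lra.
Qed.

(* With a = phi z, split R phi(z) along a and its orthogonal complement. *)
Lemma radial_der_lim (eps : R) : 0 < eps -> exists r : R, r < 1 /\
  forall z, unit_ball z -> r < nrm (phi z) ->
    (1 - nrm z ^+ 2) * nrm (radial_der phi z)
      / Num.sqrt (1 - nrm (phi z) ^+ 2) < eps.
Proof.
move=> eps0; have eps4 : 0 < eps / 4 by rewrite divr_gt0.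
have [r [r1 hr]] := test_fun_vanish ip_inner phi_ball phi_analytic Cphi_compact eps4.
have [r' [r'1 hr']] := radial_der_tangential_lim eps4.
(* The threshold 1/2 gives |<v, a>| / |a| <= 2 |<v, a>| for the component along a. *)
exists (Num.max (1 / 2) (Num.max r r')); split.
  by rewrite !gt_max r1 r'1 andbT; lra.
move=> z z1; rewrite !gt_max => /and3P[a2 rz r'z].
rewrite -/(mobius_s (phi z)).
have a1 := phi_ball z1; have s0 := mobius_s_gt0 a1.
have d0 := one_sub_sqr_gt0 z1.
have := hr' z z1 r'z; have {hr} := hr z z1 rz.
set v := radial_der phi z; set a := phi z in a1 a2 s0 *.
rewrite -(sqr_mobius_s a1) (nrm_ipC ip_inner a) => hr {}hr'.
have a0 : 0 < nrm a by apply: lt_trans a2; rewrite divr_gt0.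
pose p := (ip v a / rC (nrm a ^+ 2)) *: a.
have aa0 : rC (nrm a ^+ 2) != 0.
  by rewrite (inj_eq (@complexI R) _ 0) gt_eqF // exprn_gt0.
have ap : ip (v - p) a = 0.
  by rewrite (ipBl ip_inner) (ipZl ip_inner) (ipxx ip_inner) divfK // subrr.
have nrm_p : (1 - nrm z ^+ 2) * nrm p / mobius_s a <= eps / 2.
  have -> : nrm p = nrm (ip v a) / nrm a.
    rewrite /p nrmZ nrmM nrmV nrm_real ger0_norm ?sqr_ge0 //.
    by field; rewrite gt_eqF.
  have : nrm (ip v a) / nrm a <= 2 * nrm (ip v a).
    rewrite ler_pdivrMr // mulrAC ler_peMl ?nrm_ge0 //.
    by move: a2; rewrite ltr_pdivrMr // mulrC => /ltW.
  (* Since s_a <= 1, replacing 1 / s_a by 1 / s_a^2 only increases the bound and brings in the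
     quantity of (3). *)
  move=> hq; apply: (@le_trans _ _ (2 * ((1 - nrm z ^+ 2) * nrm (ip v a) / mobius_s a ^+ 2))).
    rewrite mulrA [2 * _]mulrCA.
    have : (mobius_s a)^-1 <= (mobius_s a ^+ 2)^-1.
      rewrite lef_pV2 ?posrE ?exprn_gt0 // expr2.
      by rewrite ler_piMl ?(ltW s0) // mobius_s_le1.
    move=> hs; apply: ler_pM => //.
    - by rewrite mulr_ge0 ?divr_ge0 ?nrm_ge0 // ltW.
    - by rewrite invr_ge0 ltW.
    - by rewrite ler_wpM2l // ltW.
  by move: hr'; lra.
have nrm_q : (1 - nrm z ^+ 2) * nrm (v - p) / mobius_s a <= eps / 4.
  have [q0|q0] := eqVneq (v - p) 0.
    by rewrite q0 nrm0 mulr0 mul0r ltW.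
  have nq : 0 < nrm (v - p) by rewrite lt_neqAle nrm_ge0 eq_sym nrm_eq0 q0.
  (* Here e is the unit vector along v - p, orthogonal to a, with <v, e> = |v - p|, and al = 0. *)
  have := hr (rC (nrm (v - p))^-1 *: (v - p)) 0.
  rewrite nrmZ nrm_real gtr0_norm ?invr_gt0 // mulVf ?gt_eqF // lexx.
  rewrite (ipZr ip_inner) (ipC ip_inner (v - p)) ap rmorph0 mulr0.
  rewrite lexx ltW // mul0r rmorph0 mul0r addr0 => /(_ isT erefl isT).
  rewrite (ipZr ip_inner) conj_rC.
  have -> : ip v (v - p) = rC (nrm (v - p) ^+ 2).
    rewrite -(ipxx ip_inner) (ipBl ip_inner v p) [ip p _](ipZl ip_inner).
    by rewrite (ipC ip_inner (v - p) a) ap rmorph0 mulr0 subr0.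
  by rewrite -rmorphM nrm_real expr2 mulrA mulVf ?gt_eqF // mul1r gtr0_norm.
have : nrm v <= nrm (v - p) + nrm p by rewrite -{1}[v](subrK p) nrmD.
move=> /(ler_wpM2l (ltW d0)) hv.
have : (1 - nrm z ^+ 2) * nrm v / mobius_s a <=
    ((1 - nrm z ^+ 2) * (nrm (v - p) + nrm p)) / mobius_s a.
  by rewrite ler_wpM2r // invr_ge0 ltW.
by rewrite mulrDr [leRHS]mulrDl; lra.
Qed.

End BoundaryLimits.

Theorem theorem4p5 (R : realType) (E : completeNormedModType R[i])
    (ip : E -> E -> R[i]) (phi : E -> E) :
  is_inner_product ip ->
  (forall z, @unit_ball R E z -> @unit_ball R E (phi z)) ->
  analytic_on (@unit_ball R E) phi ->
  compact_comp_op ip phi ->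
  [/\ (forall delta : R, 0 < delta < 1 ->
         compact (closure (phi @` [set (Complex delta 0) *: x | x in @unit_ball R E]))),
      (forall eps : R, 0 < eps -> exists r : R, r < 1 /\
         forall z, @unit_ball R E z -> r < nrm (phi z) ->
           (1 - nrm z ^+ 2) * nrm (radial_der phi z)
             / Num.sqrt (1 - nrm (phi z) ^+ 2) < eps)
    & (forall eps : R, 0 < eps -> exists r : R, r < 1 /\
         forall z, @unit_ball R E z -> r < nrm (phi z) ->
           (1 - nrm z ^+ 2) * nrm (ip (phi z) (radial_der phi z))
             / (1 - nrm (phi z) ^+ 2) < eps)].
Proof.
move=> ip_inner phi_ball phi_analytic Cphi_compact; split.
- by move=> delta; exact: (compact_image_scaled_ball ip_inner Cphi_compact).
- by move=> eps; exact: (radial_der_lim ip_inner phi_ball phi_analytic Cphi_compact).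
- by move=> eps; exact: (radial_der_tangential_lim ip_inner phi_ball phi_analytic Cphi_compact).
Qed.
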